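(* Every strictly nondistributive lattice has at least $7$ elements, and if a strictly nondistributive lattice has exactly $7$ elements, then it is isomorphic either to the extended pentagon $\overline{\mathsf N}_5$ or to the extended diamond $\overline{\mathsf M}_3$.
   Context: A lattice $L$ is strictly nondistributive if there exist $\alpha,\beta,x\in L$ such that $x\wedge(\alpha\vee\beta)\not\le (x\wedge\alpha)\vee(x\wedge\beta)$ and $x\not\le\alpha\vee\beta$. Both lattices below have the 7 elements $\bot,\alpha,\beta,\gamma,x,\top,\overline\top$; they are given by covering relations ($u\prec v$ means $v$ covers $u$): - $\overline{\mathsf N}_5$: $\bot\prec\alpha\prec\gamma\prec\top\prec\overline\top$, $\bot\prec\beta\prec\top$, $\gamma\prec x\prec\overline\top$. - $\overline{\mathsf M}_3$: $\bot\prec\alpha,\beta,\gamma$; $\alpha,\beta,\gamma\prec\top\prec\overline\top$; $\gamma\prec x\prec\overline\top$. *)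

(* Defs.v *)
From HB Require Import structures.
From mathcomp Require Import all_boot all_order.

Set Implicit Arguments.
Unset Strict Implicit.
Unset Printing Implicit Defensive.

Import Order.TTheory.
Local Open Scope order_scope.

Definition strictly_nondistributive d (L : latticeType d) : Prop :=
  exists alpha beta x : L,
    ~~ (x `&` (alpha `|` beta) <= (x `&` alpha) `|` (x `&` beta))
    /\ ~~ (x <= alpha `|` beta).

(* The inverse of a bijective lattice morphism is again a lattice morphism. *)
Definition lattice_isomorphic d (L : latticeType d) d' (L' : latticeType d') :
  Prop := exists f : {lmorphism L -> L'}, bijective f.

(* [ETop] stands for the top element with a bar. *)
Inductive seven : Type := Bot | Alpha | Beta | Gamma | Top | X | ETop.

Definition nat_of_seven (u : seven) : nat :=
  match u with
  | Bot => 0 | Alpha => 1 | Beta => 2 | Gamma => 3 | Top => 4 | X => 5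
  | ETop => 6
  end.

(* A linear extension of both orders below. *)
Definition sevens : seq seven := [:: Bot; Alpha; Beta; Gamma; Top; X; ETop].

Fact nat_of_sevenK :
  pcancel nat_of_seven (fun n => nth None (map some sevens) n).
Proof. by case. Qed.

HB.instance Definition _ := Countable.copy seven (pcan_type nat_of_sevenK).

Fact sevens_enum : Finite.axiom sevens.
Proof. by case. Qed.

HB.instance Definition _ := isFinite.Build seven sevens_enum.

(* [(u, v)] in the list means that [v] covers [u]. *)
Definition pentagon_cover : rel seven := fun u v =>
  (u, v) \in [:: (Bot, Alpha); (Alpha, Gamma); (Gamma, Top); (Top, ETop);
                 (Bot, Beta); (Beta, Top);
                 (Gamma, X); (X, ETop)].

Definition diamond_cover : rel seven := fun u v =>
  (u, v) \in [:: (Bot, Alpha); (Bot, Beta); (Bot, Gamma);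
                 (Alpha, Top); (Beta, Top); (Gamma, Top); (Top, ETop);
                 (Gamma, X); (X, ETop)].

(* A computable form of [connect e], for paths of length at most [n]. *)
Fixpoint reach (e : rel seven) (n : nat) : rel seven := fun u v =>
  (u == v) ||
  (if n is n'.+1 then has (reach e n' ^~ v) [seq w <- sevens | e u w]
   else false).

Lemma seven_ind3 (P : seven -> seven -> seven -> bool) :
  all (fun u => all (fun v => all (P u v) sevens) sevens) sevens ->
  forall u v w, P u v w.
Proof.
have sevensP w : w \in sevens by case: w.
move=> /allP Pall u v w; have allv := Pall u (sevensP u).
by have /allP/(_ v (sevensP v))/allP-> := allv.
Qed.

Lemma reach_refl e n : reflexive (reach e n).
Proof. by case: n => [|n] u /=; rewrite eqxx. Qed.

Lemma connect_reach (e : rel seven) n :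
    (forall u w v, e u w && reach e n w v ==> reach e n u v) ->
  connect e =2 reach e n.
Proof.
move=> closed u v; apply/idP/idP => [/connectP[p]|].
  elim: p u => [|w p IHp] u /=; first by move=> _ ->; apply: reach_refl.
  by move=> /andP[euw ewp] vE; apply: (implyP (closed u w v)); rewrite euw IHp.
elim: n u v {closed} => [|n IHn] u v; first by rewrite /= orbF => /eqP ->.
case/orP => [/eqP -> //|/hasP[w]]; rewrite mem_filter => /andP[euw _] /IHn.
exact: connect_trans (connect1 euw).
Qed.

(* The last lower bound and the first upper bound along [sevens]. *)
Definition seven_meet (e : rel seven) (u v : seven) : seven :=
  last Bot [seq w <- sevens | reach e 4 w u && reach e 4 w v].

Definition seven_join (e : rel seven) (u v : seven) : seven :=
  head ETop [seq w <- sevens | reach e 4 u w && reach e 4 v w].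

Lemma connect_pentagon : connect pentagon_cover =2 reach pentagon_cover 4.
Proof. by apply/connect_reach/seven_ind3; vm_compute. Qed.

Lemma connect_diamond : connect diamond_cover =2 reach diamond_cover 4.
Proof. by apply/connect_reach/seven_ind3; vm_compute. Qed.

Fact seven_display : Order.disp_t.
Proof. exact: Order.Disp tt tt. Qed.

(* The order is the reflexive transitive closure of the covering relation. *)
Definition ext_pentagon : Type := seven.
HB.instance Definition _ := Finite.on ext_pentagon.

Definition ext_diamond : Type := seven.
HB.instance Definition _ := Finite.on ext_diamond.

Fact pentagon_anti : antisymmetric (connect pentagon_cover).
Proof. by move=> u v; rewrite !connect_pentagon; case: u; case: v. Qed.

HB.instance Definition _ := Order.Le_isPOrder.Build
  seven_display ext_pentagon
  (@connect0 _ pentagon_cover) pentagon_anti (@connect_trans _ pentagon_cover).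

Fact pentagon_meetP u v w :
  connect pentagon_cover u (seven_meet pentagon_cover v w) =
  connect pentagon_cover u v && connect pentagon_cover u w.
Proof.
rewrite !connect_pentagon; apply/eqP.
by move: u v w; apply: seven_ind3; vm_compute.
Qed.

Fact pentagon_joinP u v w :
  connect pentagon_cover (seven_join pentagon_cover u v) w =
  connect pentagon_cover u w && connect pentagon_cover v w.
Proof.
rewrite !connect_pentagon; apply/eqP.
by move: u v w; apply: seven_ind3; vm_compute.
Qed.

HB.instance Definition _ := Order.POrder_MeetJoin_isLattice.Build
  seven_display ext_pentagon pentagon_meetP pentagon_joinP.

Fact diamond_anti : antisymmetric (connect diamond_cover).
Proof. by move=> u v; rewrite !connect_diamond; case: u; case: v. Qed.

HB.instance Definition _ := Order.Le_isPOrder.Build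
  seven_display ext_diamond
  (@connect0 _ diamond_cover) diamond_anti (@connect_trans _ diamond_cover).

Fact diamond_meetP u v w :
  connect diamond_cover u (seven_meet diamond_cover v w) =
  connect diamond_cover u v && connect diamond_cover u w.
Proof.
rewrite !connect_diamond; apply/eqP.
by move: u v w; apply: seven_ind3; vm_compute.
Qed.

Fact diamond_joinP u v w :
  connect diamond_cover (seven_join diamond_cover u v) w =
  connect diamond_cover u w && connect diamond_cover v w.
Proof.
rewrite !connect_diamond; apply/eqP.
by move: u v w; apply: seven_ind3; vm_compute.
Qed.

HB.instance Definition _ := Order.POrder_MeetJoin_isLattice.Build
  seven_display ext_diamond diamond_meetP diamond_joinP.

(* Main.v *)
(* From a witness [alpha, beta, x] of strict nondistributivity, put
   [top = alpha \/ beta] and [gamma = x /\ top].  The seven elements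
   [alpha /\ beta, alpha, beta, gamma, top, x, x \/ top] are always distinct.
   When they exhaust the lattice, the order is determined by whether [x] lies
   above one of [alpha], [beta] (pentagon; it cannot lie above both) or above
   none: then [alpha /\ x] can only be [alpha /\ beta], and this is a diamond. *)
Require Import Defs.
From HB Require Import structures.
From mathcomp Require Import all_boot all_order.
From mathcomp Require Import boolp classical_sets functions cardinality.

Import Order.TTheory.
Local Open Scope order_scope.

Set Implicit Arguments.
Unset Strict Implicit.
Unset Printing Implicit Defensive.

(** Meets and joins are determined by the order, so the inverse of [f] preserves them. The map
    starts from [L'] because the concrete lattice is the one whose elements can be enumerated. *)
Lemma lattice_isomorphic_mono d (L : latticeType d) d' (L' : latticeType d')
    (f : L' -> L) :
  bijective f -> {mono f : u v / u <= v} -> lattice_isomorphic L L'.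
Proof.
move=> [g fK gK] f_mono.
have g_mono : {mono g : a b / a <= b} by move=> a b; rewrite -f_mono !gK.
have g_ge a u : (u <= g a) = (f u <= a) by rewrite -{2}(gK a) f_mono.
have g_le a u : (g a <= u) = (a <= f u) by rewrite -{2}(gK a) f_mono.
have gI : Order.meet_morphism g.
  move=> a b; apply/le_anti; rewrite lexI !g_mono leIl leIr /=.
  by rewrite g_ge lexI -!g_ge leIl leIr.
have gU : Order.join_morphism g.
  move=> a b; apply/le_anti; rewrite leUx !g_mono leUl leUr andbT /=.
  by rewrite g_le leUx -!g_le leUl leUr.
have g_homo : {homo g : a b / a <= b} by move=> a b; rewrite g_mono.
pose isO := Order.isOrderMorphism.Build d L d' L' g g_homo.
pose isI := Order.isMeetLatticeMorphism.Build d L d' L' g gI.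
pose isU := Order.isJoinLatticeMorphism.Build d L d' L' g gU.
pose gM : {lmorphism L -> L'} := HB.pack g isO isI isU.
by exists gM; exists f.
Qed.

(* A pair [p] in [obs] records that the image of [p.1] is not below that of
   [p.2]; this propagates to everything above [p.1] and below [p.2]. *)
Definition separated (e : rel seven) (obs : seq (seven * seven)) : rel seven :=
  fun u v => has (fun p => reach e 4 p.1 u && reach e 4 v p.2) obs.

Section Separation.
Context {d : Order.disp_t} {L : latticeType d}.
Variables (e : rel seven) (obs : seq (seven * seven)) (f : seven -> L).
Hypothesis f_cover : forall u v, e u v -> f u <= f v.
Hypothesis f_obs : all (fun p => ~~ (f p.1 <= f p.2)) obs.

Lemma le_reach n u v : reach e n u v -> f u <= f v.
Proof.
elim: n u => [|n IHn] u; first by rewrite /= orbF => /eqP->.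
case/orP => [/eqP-> //|/hasP[w]]; rewrite mem_filter => /andP[euw _] /IHn.
exact/le_trans/f_cover.
Qed.

Lemma separated_nle u v : separated e obs u v -> ~~ (f u <= f v).
Proof.
case/hasP => p /(allP f_obs) p_obs /andP[/le_reach p1u /le_reach vp2].
by apply: contra p_obs => uv; apply/(le_trans p1u)/(le_trans uv).
Qed.

Lemma separated_inj :
    (forall u v, [|| u == v, separated e obs u v | separated e obs v u]) ->
  injective f.
Proof.
move=> total u v fuv.
by case/or3P: (total u v) => [/eqP //||] /separated_nle; rewrite fuv lexx.
Qed.

(** Reduces recognising the order of [L] to a finite check: each pair of labels is settled either by
    a chain of covers or by an observation. *)
Lemma separated_mono :
    connect e =2 reach e 4 ->
    (forall u v, reach e 4 u v || separated e obs u v) ->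
  forall u v, (f u <= f v) = connect e u v.
Proof.
move=> eE total u v; rewrite eE; apply/idP/idP => [fuv|/le_reach //].
by case/orP: (total u v) => // /separated_nle; rewrite fuv.
Qed.

End Separation.

Section Frame.
Context {d : Order.disp_t} {L : latticeType d}.
Implicit Types a b x : L.

Definition frame a b x (u : seven) : L :=
  match u with
  | Bot => a `&` b
  | Alpha => a
  | Beta => b
  | Gamma => x `&` (a `|` b)
  | Top => a `|` b
  | X => x
  | ETop => x `|` (a `|` b)
  end.

Definition witness a b x : bool :=
  ~~ (x `&` (a `|` b) <= (x `&` a) `|` (x `&` b)) && ~~ (x <= a `|` b).

(* Valid for every witness; not all of these pairs are covers in the pentagon. *)
Definition frame_cover : rel seven := fun u v =>
  (u, v) \in [:: (Bot, Alpha); (Bot, Beta); (Alpha, Top); (Beta, Top);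
                 (Gamma, Top); (Top, ETop); (Gamma, X); (X, ETop)].

Definition frame_obs : seq (seven * seven) :=
  [:: (Alpha, Beta); (Beta, Alpha); (Gamma, Alpha); (Gamma, Beta);
      (Top, X); (X, Top)].

Lemma frame_coverP a b x u v :
  frame_cover u v -> frame a b x u <= frame a b x v.
Proof. by case: u; case: v => // _; rewrite /= ?leIl ?leIr ?leUl ?leUr. Qed.

(** Each failure would restore distributivity at [x]: comparable [a] and [b] collapse the join,
    gamma below [a] or [b] lies below [x /\ a] or [x /\ b], and top below [x] turns the right-hand
    side into [a \/ b]. The pair [(X, Top)] is the second half of [witness]. *)
Lemma frame_obsP a b x :
    witness a b x ->
  all (fun p => ~~ (frame a b x p.1 <= frame a b x p.2)) frame_obs.
Proof.
case/andP => nd xt; rewrite /= xt !andbT; apply/and5P; split.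
- apply: contra nd => /join_idPl ab.
  by rewrite joinC in ab; rewrite ab leUr.
- by apply: contra nd => /join_idPl ->; rewrite leUl.
- by apply: contra nd => ga; rewrite (le_trans _ (leUl _ _)) // lexI leIl.
- by apply: contra nd => gb; rewrite (le_trans _ (leUr _ _)) // lexI leIl.
apply: contra nd; rewrite leUx => /andP[/meet_idPr -> /meet_idPr ->].
exact: leIr.
Qed.

Lemma frame_inj a b x : witness a b x -> injective (frame a b x).
Proof.
move=> w; apply: separated_inj (@frame_coverP a b x) (frame_obsP w) _.
by case; case.
Qed.

Lemma witnessC a b x : witness a b x -> witness b a x.
Proof. by rewrite /witness [b `|` a]joinC [x `&` b `|` _]joinC. Qed.

Lemma card_le_frame a b x : witness a b x -> (`I_7 #<= [set: L])%card.
Proof.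
move=> /frame_inj f_inj; apply/card_subP.
(* The default [Bot] is returned only from index 7 on, so injectivity is claimed on [I_7] alone. *)
pose h := frame a b x \o nth Bot sevens.
have h_inj : {in `I_7%classic &, injective h}.
  move=> i j; rewrite !inE => i7 j7 /f_inj /eqP.
  by rewrite nth_uniq // => /eqP.
exists (h @` `I_7)%classic => //.
by rewrite (inj_card_eq h_inj).
Qed.

Lemma frame_bij a b x :
  ([set: L] #= `I_7)%card -> witness a b x -> bijective (frame a b x).
Proof.
move=> /pcard_eqP[h] /frame_inj f_inj.
have h_lt l : (h l < 7)%N by have := @funS _ _ _ _ h l; apply.
have h_inj : injective h by move=> l m; apply: (@inj _ _ _ h); rewrite inE.
(* Counting takes place in ['I_7], as [L] is not a [finType]: an injection from [seven] is bijective
   there, and its inverse after [h] inverts the frame. *)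
pose k u : 'I_7 := Ordinal (h_lt (frame a b x u)).
have k_inj : injective k by move=> u v [/h_inj/f_inj].
have [k' _ k'K] : bijective k.
  by apply: inj_card_bij k_inj _; rewrite card_ord cardE enumT unlock.
pose g l := k' (Ordinal (h_lt l)).
have gK : cancel g (frame a b x).
  by move=> l; apply: h_inj; have [] := k'K (Ordinal (h_lt l)).
by exists g => // u; apply: f_inj; rewrite gK.
Qed.

Lemma frame_pentagon a b x :
    witness a b x -> bijective (frame a b x) -> a <= x ->
  lattice_isomorphic L ext_pentagon.
Proof.
move=> w f_bij ax; apply: (@lattice_isomorphic_mono _ _ _ ext_pentagon _ f_bij).
have obsP : all (fun p => ~~ (frame a b x p.1 <= frame a b x p.2))
                ((Beta, X) :: frame_obs).
  (* With [a <= x], having [b <= x] as well would put top below [x]. *)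
  have /allP/(_ (Top, X) isT) := frame_obsP w; rewrite leUx ax => bx.
  by apply/andP; split=> //; apply: frame_obsP.
apply: (@separated_mono _ _ pentagon_cover _ _ _ obsP).
- move=> u v; have [/frame_coverP //|] := boolP (frame_cover u v).
  (* The only cover of the pentagon outside [frame_cover] is alpha below gamma. *)
  by case: u; case: v => //= _ _; rewrite lexI ax leUl.
- exact: connect_pentagon.
by case; case.
Qed.

Lemma frame_diamond a b x :
    witness a b x -> bijective (frame a b x) -> ~~ (a <= x) -> ~~ (b <= x) ->
  lattice_isomorphic L ext_diamond.
Proof.
move=> w f_bij ax bx.
apply: (@lattice_isomorphic_mono _ _ _ ext_diamond _ f_bij).
have obsP : all (fun p => ~~ (frame a b x p.1 <= frame a b x p.2))
                ([:: (Alpha, X); (Beta, X)] ++ frame_obs).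
  by do 2!(apply/andP; split=> //); apply: frame_obsP.
have nle := separated_nle (@frame_coverP a b x) obsP.
(* By surjectivity [a /\ x] is one of the seven elements; every choice except [a /\ b] contradicts
   an observation. *)
have ab_le_x : a `&` b <= x.
  have [g _ gK] := f_bij; have := gK (a `&` x).
  case: (g _) => [/= ->|e|e|e|e|e|e]; first exact: leIr.
  - by have := nle Alpha X isT; rewrite e leIr.
  - by have := nle Beta X isT; rewrite e leIr.
  - by have := nle Gamma Alpha isT; rewrite e leIl.
  - by have := nle Top X isT; rewrite e leIr.
  - by have := nle X Alpha isT; rewrite e leIl.
  - by have := nle ETop X isT; rewrite e leIr.
apply: (@separated_mono _ _ diamond_cover _ _ _ obsP).
- move=> u v; have [/frame_coverP //|] := boolP (frame_cover u v).
  case: u; case: v => //= _ _.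
  (* The only cover of the diamond outside [frame_cover] is bottom below gamma. *)
  by rewrite lexI ab_le_x (le_trans (leIl _ _)) ?leUl.
- exact: connect_diamond.
by case; case.
Qed.

End Frame.

Local Open Scope classical_set_scope.
Local Open Scope card_scope.

Theorem corollary2p6 (d : Order.disp_t) (L : latticeType d) :
  strictly_nondistributive L ->
  (`I_7 #<= [set: L]) /\
  ([set: L] #= `I_7 ->
    lattice_isomorphic L ext_pentagon \/ lattice_isomorphic L ext_diamond).
Proof.
move=> [a [b [x /andP w]]]; split=> [|L7]; first exact: card_le_frame w.
have [ax|nax] := boolP (a <= x)%O.
  by left; apply: frame_pentagon (frame_bij L7 w) ax.
have [bx|nbx] := boolP (b <= x)%O.
  (* Same pentagon, with [a] and [b] exchanged. *)
  by left; have w' := witnessC w; apply: frame_pentagon (frame_bij L7 w') bx.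
by right; apply: frame_diamond (frame_bij L7 w) nax nbx.
Qed.
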